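(* Let $U$ be a nonempty finite set and let $\mathcal{B}$ be a Boolean sublattice of $\mathrm{Part}(U)$ with $\triangle, \nabla \in \mathcal{B}$. Then there is a Boolean sublattice of $\mathrm{Part}(U)$ that contains $\mathcal{B}$ and has the largest size among all Boolean sublattices of $\mathrm{Part}(U)$ if and only if the hypergraph $\mathcal{H}(A(\mathcal{B}))$ is a hypertree.
   Context: $\mathrm{Part}(U)$ is the lattice of all partitions of $U$ ordered by refinement ($\pi_1\le\pi_2$ iff every block of $\pi_2$ is a union of blocks of $\pi_1$); $\triangle$ is its least element (all blocks singletons) and $\nabla$ its greatest element (single block $U$). A Boolean sublattice is a sublattice (closed under meet and join of $\mathrm{Part}(U)$) that is itself a Boolean lattice. $A(\mathcal{B})$ is the set of atoms of $\mathcal{B}$. For a set $D\subseteq \mathrm{Part}(U)\setminus\{\triangle\}$ of partitions with pairwise meet $\triangle$, $\mathcal{H}(D)$ is the hypergraph with vertex set $U$ whose edges are the non-singleton blocks of all partitions in $D$ (any two distinct edges share at most one vertex). A path is a sequence $v_0,B_1,v_1,B_2,\dots,B_n,v_n$ alternating between vertices and edges, with $v_{i-1},v_i\in B_i$, in which no vertices or edges are repeated, except that possibly $v_0=v_n$; if $v_0=v_n$ it is a cycle. Thus a cycle is a sequence $v_1,B_1,v_2,B_2,\dots,v_n,B_n,v_1$ with $n\ge 3$, $v_1\in B_1\cap B_n$, $v_i\in B_{i-1}\cap B_i$ for $2\le i\le n$, where $v_1,\dots,v_n$ are distinct vertices and $B_1,\dots,B_n$ distinct edges. A hypergraph is connected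 if any two distinct vertices are connected by a path. A hypertree is a connected hypergraph without cycles. *)

(* Defs.v *)
From HB Require Import structures.
From mathcomp Require Import all_boot all_order.

Set Implicit Arguments.
Unset Strict Implicit.
Unset Printing Implicit Defensive.

Import Order.LTheory.

Local Open Scope order_scope.

Section PartitionLattice.

Variable U : finType.

Record Part := MkPart {
  blocks :> {set {set U}};
  blocksP : partition blocks [set: U] }.

HB.instance Definition _ := [isSub for blocks].
HB.instance Definition _ := [Finite of Part by <:].

Implicit Types P Q R : Part.

Definition part_le P Q : bool :=
  [forall B in blocks Q,
     [exists S : {set {set U}}, (S \subset blocks P) && (B == cover S)]].

Definition same_block P (x y : U) : bool := y \in pblock P x.

Lemma same_block_equiv P : equivalence_rel (same_block P).
Proof. by move=> x y z; apply: (pblock_equivalence (blocksP P)). Qed.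

Lemma same_blockxx P x : same_block P x x.
Proof. by case: (same_block_equiv P x x x). Qed.

Lemma same_block_sym P : symmetric (same_block P).
Proof.
case/equivalence_relP: (same_block_equiv P) => r l.
by move=> x y; apply/idP/idP => /l <-; apply: r.
Qed.

Lemma same_block_trans P : transitive (same_block P).
Proof.
by case/equivalence_relP: (same_block_equiv P) => _ l y x z /l ->.
Qed.

Lemma pblock_blocks P x : pblock P x \in blocks P.
Proof.
by apply: pblock_mem; case/and3P: (blocksP P) => /eqP-> _ _; rewrite inE.
Qed.

Lemma block_pblock P (B : {set U}) x : B \in blocks P -> x \in B -> B = pblock P x.
Proof. by move=> PB Bx; rewrite (def_pblock _ PB Bx) //; case/and3P: (blocksP P). Qed.

Lemma part_leP P Q :
  reflect (forall x y, same_block P x y -> same_block Q x y) (part_le P Q).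
Proof.
apply: (iffP 'forall_in_existsP) => [lePQ x y Pxy | lePQ B QB].
  have [S /andP[/subsetP SP /eqP defB]] := lePQ _ (pblock_blocks Q x).
  have := same_blockxx Q x; rewrite /same_block defB => /bigcupP[C SC Cx].
  apply/bigcupP; exists C => //.
  by rewrite (block_pblock (SP _ SC) Cx).
exists [set pblock P x | x in B]; apply/andP; split.
  by apply/subsetP=> _ /imsetP[x _ ->]; apply: pblock_blocks.
apply/eqP/setP=> y; apply/idP/bigcupP => [By | [_ /imsetP[x Bx ->]] Pxy].
  by exists (pblock P y); [apply: imset_f | apply: same_blockxx].
by rewrite (block_pblock QB Bx); apply: lePQ.
Qed.

Lemma part_eqP P Q : same_block P =2 same_block Q -> P = Q.
Proof.
move=> eqPQ; apply: val_inj => /=.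
rewrite -(equivalence_partition_pblock (blocksP P)).
rewrite -(equivalence_partition_pblock (blocksP Q)).
by apply: eq_imset => x; apply/setP=> y; rewrite !inE; apply: eqPQ.
Qed.

Lemma part_le_refl : reflexive part_le.
Proof. by move=> P; apply/part_leP. Qed.

Lemma part_le_anti : antisymmetric part_le.
Proof.
move=> P Q /andP[/part_leP PQ /part_leP QP]; apply: part_eqP => x y.
by apply/idP/idP; [apply: PQ | apply: QP].
Qed.

Lemma part_le_trans : transitive part_le.
Proof.
move=> Q P R /part_leP PQ /part_leP QR; apply/part_leP => x y Pxy.
by apply/QR/PQ.
Qed.

Definition part_of_rel (e : rel U) (eE : equivalence_rel e) : Part :=
  MkPart (equivalence_partitionP (in3W eE : {in [set: U] & &, equivalence_rel e})).

Lemma same_block_of_rel (e : rel U) (eE : equivalence_rel e) :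
  same_block (part_of_rel eE) =2 e.
Proof.
move=> x y; rewrite /same_block /=.
by rewrite (pblock_equivalence_partition (in3W eE)) ?inE.
Qed.

Lemma meet_rel_equiv P Q :
  equivalence_rel (fun x y => same_block P x y && same_block Q x y).
Proof.
apply/equivalence_relP; split=> [x | x y /andP[Pxy Qxy] z].
  by rewrite !same_blockxx.
case/equivalence_relP: (same_block_equiv P) => _ /(_ _ _ Pxy) ->.
by case/equivalence_relP: (same_block_equiv Q) => _ /(_ _ _ Qxy) ->.
Qed.

Definition join_step P Q : rel U :=
  fun x y => same_block P x y || same_block Q x y.

Lemma join_rel_equiv P Q : equivalence_rel (connect (join_step P Q)).
Proof.
have symc : connect_sym (join_step P Q).
  by apply: sym_connect_sym => x y; rewrite /join_step !(same_block_sym _ x).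
apply/equivalence_relP; split=> [x | x y xy z]; first exact: connect0.
by apply: (same_connect symc).
Qed.

Definition part_meet P Q : Part := part_of_rel (meet_rel_equiv P Q).
Definition part_join P Q : Part := part_of_rel (join_rel_equiv P Q).

Lemma part_meetP P Q R : part_le P (part_meet Q R) = part_le P Q && part_le P R.
Proof.
apply/part_leP/andP => [le | [/part_leP PQ /part_leP PR] x y Pxy].
  by split; apply/part_leP => x y /le; rewrite same_block_of_rel => /andP[].
by rewrite same_block_of_rel PQ ?PR.
Qed.

Lemma part_joinP P Q R : part_le (part_join P Q) R = part_le P R && part_le Q R.
Proof.
apply/part_leP/andP => [le | [/part_leP PR /part_leP QR] x y].
  by split; apply/part_leP => x y xy; apply: le; rewrite same_block_of_rel;
     apply: connect1; rewrite /join_step xy ?orbT.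
rewrite same_block_of_rel => /connectP[p pth ->].
elim: p x pth => [|z p IH] x /=; first by rewrite same_blockxx.
case/andP=> xz /IH; apply: same_block_trans.
by case/orP: xz => [/PR|/QR].
Qed.

Lemma discrete_partition : partition [set [set x] | x : U] [set: U].
Proof.
apply/and3P; split.
- apply/eqP/setP=> x; rewrite inE; apply/bigcupP.
  by exists [set x]; rewrite ?set11 ?imset_f.
- apply/trivIsetP=> _ _ /imsetP[x _ ->] /imsetP[y _ ->] neq.
  by rewrite disjoints1 inE; apply: contraNneq neq => ->.
- by apply/imsetP=> -[x _ /setP/(_ x)]; rewrite !inE eqxx.
Qed.

(* The removal of [set0] only matters when [U] is empty. *)
Lemma indiscrete_partition : partition ([set [set: U]] :\ set0) [set: U].
Proof.
apply/and3P; split; last by rewrite !inE eqxx.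
- apply/eqP/setP=> x; rewrite inE; apply/bigcupP.
  exists [set: U]; rewrite ?inE // eqxx andbT.
  by apply/set0Pn; exists x; rewrite inE.
- by apply/trivIsetP=> A B; rewrite !inE
    => /andP[_ /eqP->] /andP[_ /eqP->]; rewrite eqxx.
Qed.

Definition part_bot : Part := MkPart discrete_partition.
Definition part_top : Part := MkPart indiscrete_partition.

Lemma part_le_bot P : part_le part_bot P.
Proof.
apply/part_leP => x y; rewrite /same_block.
rewrite -(@block_pblock part_bot [set x] x) ?set11 ?imset_f //.
by rewrite inE => /eqP->; apply: same_blockxx.
Qed.

Lemma part_le_top P : part_le P part_top.
Proof.
apply/part_leP => x y _; rewrite /same_block.
rewrite -(@block_pblock part_top [set: U] x) ?inE //= eqxx andbT.
by apply/set0Pn; exists x; rewrite inE.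
Qed.

Fact part_display : Order.disp_t. Proof. exact: Order.Disp tt tt. Qed.

HB.instance Definition _ := Order.Le_isPOrder.Build part_display Part
  part_le_refl part_le_anti part_le_trans.
HB.instance Definition _ := Order.POrder_MeetJoin_isLattice.Build part_display Part
  part_meetP part_joinP.
HB.instance Definition _ := Order.hasBottom.Build part_display Part part_le_bot.
HB.instance Definition _ := Order.hasTop.Build part_display Part part_le_top.

Lemma leEpart P Q : (P <= Q) = part_le P Q. Proof. by []. Qed.

Lemma blocks_bot : blocks (\bot : Part) = [set [set x] | x : U].
Proof. by []. Qed.

Lemma blocks_top : (0 < #|U|)%N -> blocks (\top : Part) = [set [set: U]].
Proof.
case/card_gt0P=> x _; apply/setP=> B; rewrite !inE andbC.
by case: eqP => //= ->; apply/set0Pn; exists x; rewrite inE.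
Qed.

End PartitionLattice.

Section BooleanSublattices.

Variables (d : Order.disp_t) (L : finLatticeType d).
Implicit Types B : {set L}.

Definition sublattice B : Prop :=
  {in B &, forall x y, x `&` y \in B} /\ {in B &, forall x y, x `|` y \in B}.

(* The bounds [z] and [o] are those of [B], not necessarily those of [L]. *)
Definition boolean_sublattice B : Prop :=
  [/\ sublattice B,
      {in B & &, forall x y w, x `&` (y `|` w) = (x `&` y) `|` (x `&` w)}
    & exists z o : L,
      [/\ z \in B, o \in B, {in B, forall x, z <= x <= o}
        & {in B, forall x, exists2 y, y \in B & x `&` y = z /\ x `|` y = o}]].

Definition least_in B (z : L) : bool := (z \in B) && [forall x in B, z <= x].

Definition atoms B : {set L} :=
  [set a in B | [exists z, [&& least_in B z, z < a
                             & [forall x in B, ~~ (z < x < a)]]]].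

End BooleanSublattices.

Section Hypergraphs.

Variable U : finType.
Implicit Types (E : {set {set U}}) (u v : U).

Definition hyperedges (D : {set Part U}) : {set {set U}} :=
  [set B : {set U} | (1 < #|B|)%N & [exists P in D, B \in blocks P]].

(* The sequence [v0, B1, v1, ..., Bn, vn] is encoded by [v0] and
   [:: (B1, v1); ...; (Bn, vn)]. *)
Fixpoint hwalk E v (p : seq ({set U} * U)) : bool :=
  if p is (B, w) :: p' then
    [&& B \in E, v \in B, w \in B & hwalk E w p']
  else true.

Definition hverts (p : seq ({set U} * U)) : seq U := [seq s.2 | s <- p].
Definition hedges (p : seq ({set U} * U)) : seq {set U} := [seq s.1 | s <- p].
Definition hend v p : U := last v (hverts p).

Definition hpath E v p : bool :=
  [&& hwalk E v p, uniq (hedges p)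
    & uniq (v :: hverts p) || (v == hend v p) && uniq (hverts p)].

Definition hcycle E v p : bool :=
  [&& hpath E v p, v == hend v p & (3 <= size p)%N].

Definition hconnected E : Prop :=
  forall u v, u != v -> exists2 p, hpath E u p & hend u p = v.

Definition hypertree E : Prop :=
  hconnected E /\ ~ (exists v p, hcycle E v p).

End Hypergraphs.

(* Main.v *)
Require Import Defs.
From HB Require Import structures.
From mathcomp Require Import all_boot all_order zify.
Set Implicit Arguments.
Unset Strict Implicit.
Unset Printing Implicit Defensive.

Import Order.LTheory.

Local Open Scope order_scope.

(** Let [n = #|U|]. The rank [n - #|blocks P|] is strictly monotone and
submodular, so the atoms of a Boolean sublattice number at most [n - 1], and the
largest Boolean sublattices have [2 ^ (n - 1)] elements. A family of edges [B]
whose weight, the sum of the [#|B| - 1], does not exceed the rank of the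
partition it spans generates a Boolean sublattice, since submodularity forces
its subfamilies to span meets correctly. A linear hypergraph is a hypertree iff
it spans the top and satisfies this weight bound.
If it is a hypertree, replacing each edge by a star of pairs keeps all spans and
gives [n - 1] generators, hence an extension of the largest size. Conversely, in
an extension with [n - 1] atoms the rank of an element is at most the number of
atoms below it; the atoms of the given sublattice lie above disjoint sets of
these, so their ranks add up to at most [n - 1], which is the weight bound. *)

(** * Atoms of a Boolean sublattice of a finite lattice *)

Section BooleanSublatticeTheory.

Variables (d : Order.disp_t) (L : finLatticeType d) (C : {set L}) (z o : L).
Hypothesis C_meet : {in C &, forall x y, x `&` y \in C}.
Hypothesis C_join : {in C &, forall x y, x `|` y \in C}.
Hypothesis C_distr :
  {in C & &, forall x y w, x `&` (y `|` w) = (x `&` y) `|` (x `&` w)}.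
Hypotheses (Cz : z \in C) (C_zo : {in C, forall x, z <= x <= o}).
Hypothesis C_compl :
  {in C, forall x, exists2 y, y \in C & x `&` y = z /\ x `|` y = o}.

Lemma atomsP (a : L) :
  reflect [/\ a \in C, z < a & {in C, forall x, z < x -> x <= a -> x = a}]
          (a \in atoms C).
Proof.
rewrite !inE; apply: (iffP andP) => -[Ca].
  case/existsP=> t /and3P[/andP[Ct /forall_inP tmin] ta /forall_inP noC].
  have -> : z = t.
    by apply/le_anti; rewrite (tmin _ Cz) andbT; case/andP: (C_zo Ct).
  split=> // x Cx tx xa; apply/eqP; move: (noC _ Cx); rewrite tx /= lt_neqAle xa.
  by rewrite andbT negbK.
move=> za amin; split=> //; apply/existsP; exists z; apply/and3P; split=> //.
  by rewrite /least_in Cz; apply/forall_inP => x /C_zo/andP[].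
apply/forall_inP => x Cx; apply/negP => /andP[zx xa].
by move: (xa); rewrite (amin _ Cx zx (ltW xa)) ltxx.
Qed.

Lemma exists_atom (x : L) : x \in C -> z < x -> exists2 a, a \in atoms C & a <= x.
Proof.
have [k] := ubnP #|[set y in C | y < x]|; elim: k x => // k IH x; rewrite ltnS => ltk Cx zx.
have [/existsP[y /and3P[Cy zy yx]] | /existsPn nox] :=
  boolP [exists y, [&& y \in C, z < y & y < x]].
  have [||//|a aA ay] := IH y; last by exists a => //; apply: le_trans ay (ltW yx).
  - apply: leq_trans ltk; apply: proper_card; apply/properP; split.
      by apply/subsetP=> w; rewrite !inE => /andP[-> /lt_trans]; apply.
    by exists y; rewrite !inE Cy ?yx ?ltxx.
  - by [].
exists x => //; apply/atomsP; split=> // y Cy zy yx; apply/eqP.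
by move: (nox y); rewrite Cy zy lt_neqAle yx /= andbT negbK.
Qed.

(** Let [y'] be a complement of [y]. An atom below both [x] and [y'] would also lie below [y], hence
    below [z]; so [x] meets [y'] in [z], and distributivity reduces [x] to its meet with [y]. *)
Lemma le_from_atoms (x y : L) : x \in C -> y \in C ->
  (forall a, a \in atoms C -> a <= x -> a <= y) -> x <= y.
Proof.
move=> Cx Cy le_at; have [y' Cy' [yy'z yy'o]] := C_compl Cy.
have zE : x `&` y' = z.
  apply/eqP; case/andP: (C_zo (C_meet Cx Cy')) => zle _.
  apply: contraTT isT => neq.
  have [|a aA] := exists_atom (C_meet Cx Cy').
    by rewrite lt_neqAle eq_sym neq.
  rewrite lexI => /andP[ax ay']; have ay := le_at a aA ax.
  have /atomsP[_ za _] := aA.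
  have: a <= z by rewrite -yy'z lexI ay.
  by move/(lt_le_trans za); rewrite ltxx.
have xo : x <= o by case/andP: (C_zo Cx).
rewrite -(meet_l xo) -yy'o C_distr // zE join_l ?leIr //.
by case/andP: (C_zo (C_meet Cx Cy)).
Qed.

Lemma card_boolean_sublattice : (#|C| <= 2 ^ #|atoms C|)%N.
Proof.
rewrite -card_powerset -(card_in_imset (f := fun x => [set a in atoms C | a <= x])).
  apply: subset_leq_card; apply/subsetP=> _ /imsetP[x _ ->].
  by rewrite powersetE; apply/subsetP=> a; rewrite inE => /andP[].
move=> x y Cx Cy /setP eqxy.
have {}eqxy a : a \in atoms C -> (a <= x) = (a <= y).
  by move=> aA; have := eqxy a; rewrite [LHS]in_set [RHS]in_set aA.
by apply: le_anti; rewrite !le_from_atoms // => a aA; rewrite eqxy.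
Qed.

Lemma meet_atom (x a : L) : x \in C -> a \in atoms C -> ~~ (a <= x) -> a `&` x = z.
Proof.
move=> Cx /atomsP[Ca za amin] nax; apply/eqP; apply: contraNT nax => neq.
case/andP: (C_zo (C_meet Ca Cx)) => zle _.
have -> // : a = a `&` x; last by rewrite leIr.
by rewrite [RHS]amin ?leIl ?C_meet // lt_neqAle eq_sym neq.
Qed.

(** Joining the atoms of [S] to [x] one at a time gives a strictly increasing chain in [C], and each
    step raises [r] by at least one. *)
Lemma atoms_above_leq (r : L -> nat) (x : L) (S : {set L}) :
    {homo r : u v / (u < v)%O >-> (u < v)%N} ->
    x \in C -> {in S, forall a, (a \in atoms C) && ~~ (a <= x)} ->
  (r x + #|S| <= r o)%N.
Proof.
move=> r_mono; have [k] := ubnP #|S|; elim: k x S => // k IH x S; rewrite ltnS => ltk Cx Sx.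
have [-> | [a aS]] := set_0Vmem S.
  rewrite cards0 addn0; case/andP: (C_zo Cx) => _.
  by rewrite le_eqVlt => /predU1P[-> // | /r_mono/ltnW].
have /andP[aA nax] := Sx a aS; have /atomsP[Ca za _] := aA.
rewrite (cardsD1 a) aS /= in ltk *; rewrite addnA addn1.
apply: (leq_trans _ (IH (x `|` a) (S :\ a) _ _ _)) => //; last 2 first.
- exact: C_join.
- move=> b; rewrite in_setD1 => /andP[nba bS].
  have /andP[bA nbx] := Sx b bS; rewrite bA /=.
  have /atomsP[Cb zb bmin] := bA.
  (* If [b] were below the join of [x] and [a], distributivity would make it the join of its meets
     with [x] and [a], both equal to [z]. *)
  apply/negP => /meet_l; rewrite C_distr // (meet_atom Cx) //.
  rewrite (meet_atom Ca) ?joinxx // => [zE|]; first by rewrite zE ltxx in zb.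
  apply: contraNN nba => ba; have /atomsP[_ _ amin] := aA.
  by rewrite (amin b).
rewrite leq_add2r; apply: r_mono; rewrite lt_neqAle leUl andbT.
by apply: contraNneq nax => ->; rewrite leUr.
Qed.

End BooleanSublatticeTheory.

(** * The rank of a partition and its submodularity *)

Section Rank.

Variable U : finType.
Implicit Types (P Q R M : Part U) (B : {set U}) (F S : {set {set U}}).

Definition clump_rel B : rel U := fun x y => (x == y) || (x \in B) && (y \in B).

Lemma clump_rel_equiv B : equivalence_rel (clump_rel B).
Proof.
apply/equivalence_relP; split=> [x | x y]; first by rewrite /clump_rel eqxx.
case/orP=> [/eqP-> // | /andP[Bx By] w]; rewrite /clump_rel Bx By /=.
by case: eqP => [<-|_]; case: eqP => [<-|_]; rewrite ?Bx ?By ?orbT.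
Qed.

(** Every block other than [B] is a singleton; for [B] with at most one point this is the bottom. *)
Definition clump B : Part U := part_of_rel (clump_rel_equiv B).

Lemma same_block_clump B : same_block (clump B) =2 clump_rel B.
Proof. exact: same_block_of_rel. Qed.

Lemma same_block_le P Q x y : P <= Q -> same_block P x y -> same_block Q x y.
Proof. by move/part_leP; apply. Qed.

Lemma same_block_bot x y : same_block (\bot : Part U) x y = (x == y).
Proof.
apply/idP/eqP => [|->]; last exact: same_blockxx.
move/(same_block_le (le0x (clump set0))).
by rewrite same_block_clump /clump_rel !inE orbF => /eqP.
Qed.

Lemma clump_leP B P :
  reflect {in B &, forall x y, same_block P x y} (clump B <= P).
Proof.
apply: (iffP (part_leP _ _)) => [le x y Bx By | le x y].
  by apply: le; rewrite same_block_clump /clump_rel Bx By orbT.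
rewrite same_block_clump => /orP[/eqP-> | /andP[]]; last exact: le.
exact: same_blockxx.
Qed.

Lemma clumpT : clump [set: U] = \top.
Proof.
by apply/le_anti; rewrite lex1 /=; apply/part_leP => x y _;
  rewrite same_block_clump /clump_rel !inE orbT.
Qed.

(** A form of the join of [P] with [clump B] free of transitive closure, which makes its blocks
    countable. *)
Definition merge_rel P B : rel U := fun x y => same_block P x y ||
  [exists u in B, same_block P u x] && [exists u in B, same_block P u y].

Lemma merge_rel_equiv P B : equivalence_rel (merge_rel P B).
Proof.
have dP x y : same_block P x y ->
    [exists u in B, same_block P u x] = [exists u in B, same_block P u y].
  move=> xy; apply: eq_existsb => u; congr (_ && _); apply/idP/idP => ux.
    exact: same_block_trans xy.
  by apply: same_block_trans ux _; rewrite same_block_sym.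
apply/equivalence_relP; split=> [x | x y]; first by rewrite /merge_rel same_blockxx.
case/orP=> [xy | /andP[dx dy]] w; rewrite /merge_rel.
  rewrite (dP _ _ xy); case/equivalence_relP: (same_block_equiv P) => _ /(_ _ _ xy).
  by move->.
rewrite dx dy /=; case: (boolP [exists u in B, same_block P u w]) => dw.
  by rewrite !orbT.
rewrite !orbF; apply/idP/idP => /dP e; first by rewrite -e dx in dw.
by rewrite -e dy in dw.
Qed.

Lemma join_clumpE P B :
  same_block (P `|` clump B) =2 merge_rel P B.
Proof.
move=> x y; rewrite -(same_block_of_rel (merge_rel_equiv P B)).
apply: (f_equal (fun R => same_block R x y)); apply: le_anti; apply/andP; split.
  rewrite leUx; apply/andP; split.
    by apply/part_leP => u v uv; rewrite same_block_of_rel /merge_rel uv.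
  apply/clump_leP => u v Bu Bv; rewrite same_block_of_rel /merge_rel.
  rewrite orbC; apply/orP; left; apply/andP.
  by split; apply/exists_inP; [exists u | exists v]; rewrite ?same_blockxx.
apply/part_leP => u v; rewrite same_block_of_rel => /orP[|/andP[]].
  exact/same_block_le/leUl.
case/exists_inP=> u' Bu' u'u /exists_inP[v' Bv' v'v].
have PR : P <= P `|` clump B by apply: leUl.
apply: (same_block_trans (y := u')).
  by rewrite same_block_sym (same_block_le PR).
apply: (same_block_trans (y := v')); last exact: same_block_le v'v.
by have /clump_leP := leUr (clump B) P; apply.
Qed.

Lemma blocksE P : blocks P = [set pblock P x | x in [set: U]].
Proof.
apply/setP=> B; apply/idP/imsetP => [PB | [x _ ->]]; last exact: pblock_blocks.
have /set0Pn[x Bx] : B != set0.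
  by case/and3P: (blocksP P) => _ _; apply: contraNneq => <-.
by exists x; rewrite ?inE // (block_pblock PB Bx).
Qed.

Lemma eq_pblockE P x y : (pblock P x == pblock P y) = same_block P x y.
Proof.
have [cov triv _] := and3P (blocksP P).
by rewrite eq_pblock ?(eqP cov) ?inE // /same_block.
Qed.

(** The blocks of [P] that meet [B] fuse into one block, and all the others survive unchanged. *)
Lemma card_blocks_join_clump P B : B != set0 ->
  (#|blocks (P `|` clump B)| + #|[set pblock P x | x in B]| = #|blocks P| + 1)%N.
Proof.
case/set0Pn=> b Bb; pose R := P `|` clump B.
(* [D] is the union of the blocks of [P] that meet [B]: a single block of the join, outside which
   both partitions agree. *)
pose D := [set x | [exists u in B, same_block P u x]].
have Db : b \in D by rewrite inE; apply/exists_inP; exists b; rewrite ?same_blockxx.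
have RE x y : (pblock R x == pblock R y) = same_block P x y || (x \in D) && (y \in D).
  by rewrite eq_pblockE join_clumpE /merge_rel !inE.
have PD : [set pblock P x | x in D] = [set pblock P x | x in B].
  apply/setP=> X; apply/imsetP/imsetP => -[x].
    rewrite inE => /exists_inP[u Bu ux] ->; exists u => //.
    by apply/eqP; rewrite eq_pblockE same_block_sym.
  move=> Bx ->; exists x => //; rewrite inE; apply/exists_inP.
  by exists x; rewrite ?same_blockxx.
have Pout : {in ~: D, forall x, pblock R x = pblock P x}.
  move=> x; rewrite in_setC => nDx; apply/setP=> y.
  have := RE x y; rewrite eq_pblockE /same_block (negbTE nDx) orbF; exact.
have -> : #|blocks P| = #|[set pblock P x | x in D] :|: [set pblock P x | x in ~: D]|.
  by rewrite [blocks P in LHS]blocksE -imsetU setUCr.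
have -> : #|blocks R| = #|pblock R b |: [set pblock P x | x in ~: D]|.
  congr #|pred_of_set _|; rewrite [LHS]blocksE -(setUCr D) imsetU (eq_in_imset Pout); congr (_ :|: _).
  apply/setP=> X; rewrite inE; apply/imsetP/eqP => [[x Dx ->] | ->]; last by exists b.
  by apply/eqP; rewrite RE Dx Db orbT.
rewrite cardsU1 PD cardsU.
have -> : pblock R b \notin [set pblock P x | x in ~: D].
  apply/imsetP => -[x nDx]; rewrite -Pout // => /eqP; rewrite RE.
  move: nDx; rewrite in_setC => nDx; rewrite (negbTE nDx) andbF orbF => bx.
  by case/negP: nDx; rewrite inE; apply/exists_inP; exists b.
rewrite (_ : _ :&: _ = set0) ?cards0 ?subn0; first by rewrite /=; lia.
apply/setP=> X; rewrite !inE; apply/negP => /andP[/imsetP[x Bx ->] /imsetP[y]].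
rewrite in_setC => nDy /eqP; rewrite eq_pblockE => xy; case/negP: nDy.
by rewrite inE; apply/exists_inP; exists x.
Qed.

Definition part_rank P : nat := #|U| - #|blocks P|.

Lemma card_blocks_le P : (#|blocks P| <= #|U|)%N.
Proof. by rewrite blocksE (leq_trans (leq_imset_card _ _)) ?cardsT. Qed.

Lemma part_rank_join_clump P B : B != set0 ->
  (part_rank (P `|` clump B) + 1 = part_rank P + #|[set pblock P x | x in B]|)%N.
Proof.
move/(card_blocks_join_clump P); rewrite /part_rank.
have := card_blocks_le P; have := card_blocks_le (P `|` clump B); lia.
Qed.

Lemma part_rank_le P Q : P <= Q -> (part_rank P <= part_rank Q)%N.
Proof.
move=> lePQ; apply: leq_sub2l.
(* Sending a block of [P] to the block of [Q] around it is onto. Any representative gives the same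
   value, and the default [set0] never occurs, since blocks are nonempty. *)
pose f (X : {set U}) := if [pick x in X] is Some x then pblock Q x else set0 : {set U}.
apply: (leq_trans _ (leq_imset_card f (blocks P))); apply: subset_leq_card.
apply/subsetP=> X; rewrite blocksE => /imsetP[x _ ->].
apply/imsetP; exists (pblock P x); first exact: pblock_blocks.
rewrite /f; case: pickP => [y Py | /(_ x)]; last by rewrite [_ \in _]same_blockxx.
by apply/eqP; rewrite eq_pblockE; apply: same_block_le Py.
Qed.

Lemma join_clump2_rank P x y :
  ~~ same_block P x y -> part_rank (P `|` clump [set x; y]) = (part_rank P).+1.
Proof.
move=> nxy; have xy0 : [set x; y] != set0 by apply/set0Pn; exists x; rewrite set21.
have := part_rank_join_clump P xy0.
by rewrite imsetU !imset_set1 cards2 eq_pblockE nxy /=; lia.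
Qed.

Lemma ltP_same_block P Q : P < Q -> exists x y, same_block Q x y /\ ~~ same_block P x y.
Proof.
rewrite lt_leAnge => /andP[_ nQP].
have [/existsP[x /existsP[y /andP[]]] | no] :=
  boolP [exists x, exists y, same_block Q x y && ~~ same_block P x y].
  by exists x, y.
case/negP: nQP; apply/part_leP => x y Qxy; apply: contraNT no => nPxy.
by apply/existsP; exists x; apply/existsP; exists y; rewrite Qxy.
Qed.

Lemma clump2_le P x y : (clump [set x; y] <= P) = same_block P x y.
Proof.
apply/clump_leP/idP => [|xy u v]; first by apply; rewrite !inE eqxx ?orbT.
by rewrite !inE => /orP[]/eqP-> /orP[]/eqP->; rewrite ?same_blockxx // same_block_sym.
Qed.

(** A pair of points joined in [Q] but not in [P], when added to [P], raises the rank by exactly one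
    and stays below [Q]. *)
Lemma part_rank_lt : {homo part_rank : P Q / (P < Q)%O >-> (P < Q)%N}.
Proof.
move=> P Q ltPQ; have [x [y [Qxy nPxy]]] := ltP_same_block ltPQ.
rewrite -(join_clump2_rank nPxy); apply: part_rank_le.
by rewrite leUx ltW //= clump2_le.
Qed.

Lemma part_rank_eq P Q : P <= Q -> (part_rank Q <= part_rank P)%N -> P = Q.
Proof.
by rewrite le_eqVlt => /predU1P[// | /part_rank_lt]; rewrite ltnNge => /negP.
Qed.

Lemma part_rank_join_clump_le P B :
  (part_rank (P `|` clump B) <= part_rank P + #|B|.-1)%N.
Proof.
have [-> | B0] := eqVneq B set0.
  suff /join_l-> : clump set0 <= P by rewrite leq_addr.
  by apply/clump_leP => x y; rewrite inE.
rewrite -(leq_add2r 1) part_rank_join_clump // -addnA leq_add2l addn1.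
by rewrite prednK ?card_gt0 // leq_imset_card.
Qed.

(** Climb from [M] to [Q] by adding pairs: each pair raises the rank of [M] by one, that of [P] by
    at most one, and leaves the join of [P] and [Q] unchanged. Having [M] a free lower bound instead
    of the meet lets the induction move it together with [P]. *)
Lemma part_rank_submod_below P Q M : M <= P -> M <= Q ->
  (part_rank (P `|` Q) + part_rank M <= part_rank P + part_rank Q)%N.
Proof.
have [k] := ubnP (part_rank Q - part_rank M)%N.
elim: k P M => // k IH P M; rewrite ltnS => ltk MP MQ.
have [QM | ] := boolP (Q <= M).
  have <- : Q = M by apply/le_anti; rewrite QM.
  by rewrite join_l // (le_trans QM).
move=> nQM; have ltMQ : M < Q by rewrite lt_leAnge MQ.
have [x [y [Qxy nMxy]]] := ltP_same_block ltMQ.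
have rM := join_clump2_rank nMxy; have rltMQ := part_rank_lt ltMQ.
have exy : clump [set x; y] <= Q by rewrite clump2_le.
have MP' : M `|` clump [set x; y] <= P `|` clump [set x; y] by apply: leU2.
have MQ' : M `|` clump [set x; y] <= Q by rewrite leUx MQ.
have := IH _ _ _ MP' MQ'; rewrite rM -joinA (join_r exy).
have := part_rank_join_clump_le P [set x; y]; rewrite cards2.
case: eqP => _; lia.
Qed.

Lemma part_rank_submod P Q :
  (part_rank (P `|` Q) + part_rank (P `&` Q) <= part_rank P + part_rank Q)%N.
Proof. by apply: part_rank_submod_below; rewrite ?leIl ?leIr. Qed.

Lemma part_rank_bot : part_rank \bot = 0%N.
Proof.
rewrite /part_rank blocks_bot card_imset ?subnn //; exact: set1_inj.
Qed.

Lemma part_rank_top : (0 < #|U|)%N -> part_rank \top = #|U|.-1.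
Proof. by move=> U0; rewrite /part_rank blocks_top // cards1 subn1. Qed.

End Rank.

(** * Partitions spanned by families of edges *)

Section Span.

Variable U : finType.
Implicit Types (P Q R : Part U) (B : {set U}) (E F S T : {set {set U}}).

Lemma setU_setD (T : finType) (A B : {set T}) : A :|: (B :\: A) = A :|: B.
Proof. by apply/setP=> x; rewrite !inE; case: (x \in A). Qed.

Definition span S : Part U := \join_(B in S) clump B.

Definition weight S : nat := \sum_(B in S) #|B|.-1.

(** The reverse inequality always holds ([part_rank_span_le]), so this is equality: the edges of [S]
    are independent, as in a forest. *)
Definition tight S : bool := (weight S <= part_rank (span S))%N.

Lemma span_leP S P : reflect {in S, forall B, clump B <= P} (span S <= P).
Proof. exact: joinsP. Qed.

Lemma clump_le_span S B : B \in S -> clump B <= span S.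
Proof. by move=> SB; apply: joins_sup. Qed.

Lemma span_sub S T : S \subset T -> span S <= span T.
Proof.
by move/subsetP=> sST; apply/span_leP => B /sST; apply: clump_le_span.
Qed.

Lemma spanU S T : span (S :|: T) = span S `|` span T.
Proof.
apply/le_anti/andP; split; last by rewrite leUx !span_sub ?subsetUl ?subsetUr.
apply/span_leP => B; rewrite in_setU => /orP[] /clump_le_span le.
  exact: le_trans le (leUl _ _).
exact: le_trans le (leUr _ _).
Qed.

Lemma span1 B : span [set B] = clump B.
Proof. by rewrite /span big_set1. Qed.

Lemma weightD1 S B : B \in S -> weight S = (#|B|.-1 + weight (S :\ B))%N.
Proof. exact: big_setD1. Qed.

Lemma weight_setID S T : weight S = (weight (S :&: T) + weight (S :\: T))%N.
Proof. exact: big_setID. Qed.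

Lemma weightUI S T : (weight (S :|: T) + weight (S :&: T) = weight S + weight T)%N.
Proof.
rewrite (weight_setID (S :|: T) S) (weight_setID T S) setUK setDUl setDv set0U.
by rewrite (setIC T S); lia.
Qed.

Lemma part_rank_join_span P S : (part_rank (P `|` span S) <= part_rank P + weight S)%N.
Proof.
have [k] := ubnP #|S|; elim: k S => // k IH S; rewrite ltnS => ltk.
have [-> | [B SB]] := set_0Vmem S.
  by rewrite /span big_set0 joinx0 leq_addr.
rewrite (weightD1 SB) -(setD1K SB) spanU span1 joinCA joinC setD1K //.
apply: leq_trans (part_rank_join_clump_le _ _) _.
rewrite addnCA addnC leq_add2l; apply: IH.
by rewrite (cardsD1 B) SB in ltk.
Qed.

Lemma part_rank_span_le S : (part_rank (span S) <= weight S)%N.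
Proof. by have := part_rank_join_span \bot S; rewrite join0x part_rank_bot. Qed.

Lemma tight_rank S : tight S -> part_rank (span S) = weight S.
Proof. by move=> tS; apply/eqP; rewrite eqn_leq part_rank_span_le. Qed.

(** The edges of [T] outside [S] add at most their weight to the rank, so a deficit in [S] would
    persist in [T]. *)
Lemma tight_sub S T : S \subset T -> tight T -> tight S.
Proof.
move=> sST; rewrite /tight => tT.
have := part_rank_join_span (span S) (T :\: S).
by rewrite -spanU setU_setD (setUidPr sST); rewrite (weight_setID T S)
  (setIidPr sST) in tT; lia.
Qed.

(** Only the upper bound on the meet is at stake. Subfamilies of [F] have rank equal to weight, and
    weight is modular, so submodularity bounds the rank of the meet by the weight of the
    intersection; comparable partitions of equal rank coincide. *)
Lemma tight_spanI F S T : tight F -> S \subset F -> T \subset F ->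
  span (S :&: T) = span S `&` span T.
Proof.
move=> tF sSF sTF; have tR (X : {set {set U}}) : X \subset F -> part_rank (span X) = weight X.
  by move=> sXF; apply/tight_rank/tight_sub/tF.
apply: part_rank_eq; first by rewrite lexI !span_sub ?subsetIl ?subsetIr.
have := part_rank_submod (span S) (span T); rewrite -spanU !tR //.
- by have := weightUI S T; lia.
- by rewrite subIset ?sSF.
- by rewrite subUset sSF.
Qed.

(** * The Boolean sublattice generated by a tight family *)

Section SpanSublattice.

Variable F : {set {set U}}.
Hypotheses (tF : tight F) (F_gt1 : {in F, forall B, (1 < #|B|)%N}).

Lemma tight_span_inj : {in powerset F &, injective span}.
Proof.
have sub (S T : {set {set U}}) : S \subset F -> T \subset F -> span S = span T -> S \subset T.
  move=> sSF sTF eST; apply/subsetP=> B SB; apply: contraLR isT => nTB.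
  (* The intersection of [S] and [T] then has the same span, hence the same weight, as [S]; but [B]
     lies outside it and has positive weight. *)
  have := tight_spanI tF sSF sTF; rewrite -eST meetxx => eI.
  have: part_rank (span (S :&: T)) = part_rank (span S) by rewrite eI.
  rewrite !tight_rank ?(tight_sub _ tF) // ?subIset ?sSF //.
  rewrite (weight_setID S T) (@weightD1 (S :\: T) B) ?inE ?SB ?nTB //.
  by have := F_gt1 (subsetP sSF _ SB); lia.
move=> S T; rewrite !powersetE => sSF sTF eST.
by apply/eqP; rewrite eqEsubset (sub S T) ?(sub T S).
Qed.

Definition span_sublattice : {set Part U} := [set span S | S in powerset F].

Lemma card_span_sublattice : #|span_sublattice| = (2 ^ #|F|)%N.
Proof. by rewrite card_in_imset ?card_powerset //; apply: tight_span_inj. Qed.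

Lemma span_sublatticeP P :
  reflect (exists2 S : {set {set U}}, S \subset F & P = span S) (P \in span_sublattice).
Proof.
by apply: (iffP imsetP) => -[S sSF ->]; exists S => //; rewrite powersetE in sSF *.
Qed.

Lemma span_sublattice_boolean : boolean_sublattice span_sublattice.
Proof.
have inC (S : {set {set U}}) : S \subset F -> span S \in span_sublattice.
  by move=> sSF; apply/span_sublatticeP; exists S.
have sU (S T : {set {set U}}) : S \subset F -> T \subset F -> S :|: T \subset F.
  by rewrite subUset => -> ->.
have sI (S T : {set {set U}}) : S \subset F -> S :&: T \subset F.
  by move=> sSF; rewrite subIset ?sSF.
split.
- split=> P Q /span_sublatticeP[S sSF ->] /span_sublatticeP[T sTF ->].
    by rewrite -(tight_spanI tF) // inC ?sI.
  by rewrite -spanU inC ?sU.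
- move=> P Q R /span_sublatticeP[S sS ->] /span_sublatticeP[T sT ->].
  case/span_sublatticeP => W sW ->; rewrite -spanU.
  by rewrite -!(tight_spanI tF) ?sU // setIUr spanU.
exists (span set0), (span F); split; try by apply: inC; rewrite ?sub0set.
  by move=> _ /span_sublatticeP[S sS ->]; rewrite !span_sub ?sub0set.
move=> _ /span_sublatticeP[S sS ->]; exists (span (F :\: S)).
  by rewrite inC ?subsetDl.
rewrite -(tight_spanI tF) ?subsetDl // -spanU; split; congr span.
  by apply/setP=> B; rewrite !inE; case: (B \in S); rewrite ?andbF.
by rewrite setU_setD; apply/setUidPr.
Qed.

End SpanSublattice.

(** * Replacing edges by stars of pairs *)

Definition star B : {set {set U}} :=
  if [pick x in B] is Some b then [set [set b; x] | x in B :\ b] else set0.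

Definition stars S : {set {set U}} := \bigcup_(B in S) star B.

Lemma star_card2 B X : X \in star B -> #|X| = 2.
Proof.
rewrite /star; case: pickP => [b Bb | _]; last by rewrite inE.
by case/imsetP=> x; rewrite !inE => /andP[nxb _] ->; rewrite cards2 eq_sym nxb.
Qed.

Lemma stars_card2 S : {in stars S, forall B, #|B| = 2}.
Proof. by move=> X /bigcupP[B _]; apply: star_card2. Qed.

Lemma card_star B : (#|star B| <= #|B|.-1)%N.
Proof.
rewrite /star; case: pickP => [b Bb | _]; last by rewrite cards0.
by rewrite (cardsD1 b B) Bb leq_imset_card.
Qed.

Lemma span_star B : span (star B) = clump B.
Proof.
apply/le_anti/andP; split.
  apply/span_leP => X; rewrite /star; case: pickP => [b Bb | _]; last by rewrite inE.
  case/imsetP=> x; rewrite !inE => /andP[_ Bx] ->.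
  by rewrite clump2_le same_block_clump /clump_rel Bb Bx orbT.
apply/clump_leP => x y; rewrite /star; case: pickP => [b Bb | -> //].
have sb u : u \in B -> same_block (span [set [set b; x] | x in B :\ b]) b u.
  move=> Bu; have [-> | nub] := eqVneq u b; first exact: same_blockxx.
  rewrite -clump2_le; apply: clump_le_span; apply/imsetP.
  by exists u; rewrite ?inE ?nub.
move=> /sb bx /sb; apply: same_block_trans; by rewrite same_block_sym.
Qed.

Lemma span_stars S : span (stars S) = span S.
Proof.
apply/le_anti/andP; split; apply/span_leP => B.
  case/bigcupP=> X SX /clump_le_span; rewrite span_star.
  by move/le_trans; apply; apply: clump_le_span.
by move=> SB; rewrite -span_star span_sub // (bigcup_sup _ SB).
Qed.

Lemma weight_stars S : weight (stars S) = #|stars S|.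
Proof. by rewrite -sum1_card; apply: eq_bigr => X /stars_card2->. Qed.

Lemma card_stars S : (#|stars S| <= weight S)%N.
Proof.
rewrite /stars /weight; apply: (big_ind2 (fun (X : {set {set U}}) k => #|X| <= k)%N).
- by rewrite cards0.
- by move=> X k Y l hX hY; apply: leq_trans (leq_card_setU _ _) (leq_add hX hY).
- by move=> B _; apply: card_star.
Qed.

(** Passing to stars keeps the span and does not increase the weight. *)
Lemma tight_stars S : tight S -> tight (stars S).
Proof.
by rewrite /tight span_stars weight_stars; apply: leq_trans; apply: card_stars.
Qed.

Lemma star_sublattice E : (0 < #|U|)%N -> tight E -> span E = \top ->
  boolean_sublattice (span_sublattice (stars E)) /\
  #|span_sublattice (stars E)| = (2 ^ #|U|.-1)%N.
Proof.
move=> U0 /tight_stars tE sE; have E1 : {in stars E, forall B, (1 < #|B|)%N}.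
  by move=> X /stars_card2->.
split; first exact: span_sublattice_boolean.
rewrite card_span_sublattice // -weight_stars -tight_rank //.
by rewrite span_stars sE part_rank_top.
Qed.

Lemma span_in_star_sublattice E S : S \subset E -> span S \in span_sublattice (stars E).
Proof.
move=> /subsetP sSE; apply/span_sublatticeP; exists (stars S).
  by apply/bigcupsP => B SB; apply: bigcup_sup; apply: sSE.
by rewrite span_stars.
Qed.

(** The one-edge family consisting of all of [U] is tight and spans the top, so its star generates a
    sublattice of the required size. *)
Lemma exists_large_boolean_sublattice : (0 < #|U|)%N ->
  exists2 C : {set Part U}, boolean_sublattice C & #|C| = (2 ^ #|U|.-1)%N.
Proof.
move=> U0; have sT : span [set [set: U]] = \top by rewrite span1 clumpT.
have [|bC cC] := star_sublattice U0 _ sT; last by exists (span_sublattice (stars [set [set: U]])).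
by rewrite /tight /weight big_set1 sT part_rank_top // cardsT.
Qed.

End Span.

(** * Walks, cycles and the rank characterization of hypertrees *)

Section Walks.

Variable U : finType.
Implicit Types (B : {set U}) (E S : {set {set U}}) (u v : U) (p q : seq ({set U} * U)).

Lemma hend_cat v p q : hend v (p ++ q) = hend (hend v p) q.
Proof. by rewrite /hend /hverts map_cat last_cat. Qed.

Lemma hwalk_cat E v p q : hwalk E v (p ++ q) = hwalk E v p && hwalk E (hend v p) q.
Proof. by elim: p v => //= -[B w] p IH v; rewrite IH -!andbA. Qed.

Lemma hwalk_edges E S v p :
  hwalk E v p -> {subset hedges p <= S} -> hwalk S v p.
Proof.
elim: p v => //= -[B w] p IH v /and4P[_ -> -> pw] sub; apply/and4P; split=> //.
  by apply: sub; rewrite mem_head.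
by apply: IH pw _ => X pX; apply: sub; rewrite inE pX orbT.
Qed.

Lemma hwalk_sub E v p : hwalk E v p -> {subset hedges p <= E}.
Proof.
elim: p v => //= -[B w] p IH v /and4P[EB _ _ /IH sub] X.
by rewrite inE => /predU1P[-> | /sub].
Qed.

Lemma hwalk_span E v p : hwalk E v p -> same_block (span E) v (hend v p).
Proof.
elim: p v => [v _ | [B w] p IH v /= /and4P[EB Bv Bw /IH]]; first exact: same_blockxx.
by apply: same_block_trans; have /clump_leP := clump_le_span EB; apply.
Qed.

(** The reachability relation by walks is an equivalence whose partition lies above every [clump B],
    hence above the span. *)
Lemma span_hwalk E u v :
  same_block (span E) u v -> exists2 p, hwalk E u p & hend u p = v.
Proof.
pose e : rel U := fun x y => [exists B in E, (x \in B) && (y \in B)].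
have eE : equivalence_rel (connect e).
  have symc : connect_sym e.
    apply: sym_connect_sym => x y; apply: eq_existsb => B.
    by rewrite (andbC (x \in B)).
  apply/equivalence_relP; split=> [x | x y xy z]; first exact: connect0.
  exact: (same_connect symc).
have: span E <= part_of_rel eE.
  apply/span_leP => B EB; apply/clump_leP => x y Bx By.
  rewrite same_block_of_rel connect1 //; apply/exists_inP; exists B => //.
  by rewrite Bx.
move/same_block_le => le /le; rewrite same_block_of_rel => /connectP[s].
elim: s u {le} => [|w s IH] u /=; first by move=> _ ->; exists [::].
case/andP=> /exists_inP[B EB /andP[Bu Bw]] /IH{}IH /IH[p pE pv].
by exists ((B, w) :: p); rewrite //= EB Bu Bw.
Qed.

(** Shorten the tail first, then prepend the step from [u] through [B]. If [u] recurs, keep only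
    what follows it; if [B] recurs, go from [u] directly to the vertex by which the later use of [B]
    leaves. *)
Lemma hwalk_simple E u p : hwalk E u p ->
  exists q, [/\ hwalk E u q, uniq (hedges q), uniq (u :: hverts q) & hend u q = hend u p].
Proof.
elim: p u => [u _ | [B w] p IH u /= /and4P[EB Bu Bw /IH[q [qE qe qv qend]]]].
  by exists [::].
rewrite -[hend u _]/(hend w p) -{}qend.
have [-> | nuw] := eqVneq u w; first by exists q.
have [/mapP[[X x] xq /= ux] | nuq] := boolP (u \in hverts q).
  case/splitPr: xq qE qe qv => q1 q2; rewrite -{x}ux hwalk_cat /hedges /hverts !map_cat /=.
  rewrite cat_uniq => /and5P[_ _ _ _ q2E] /and4P[_ _ _ q2e].
  rewrite mem_cat cat_uniq => /and4P[_ _ _ q2v].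
  by exists q2; rewrite /= ?q2E ?q2e ?q2v // /hend /hverts map_cat last_cat.
have [/mapP[[X x] xq /= BX] | nBq] := boolP (B \in hedges q).
  case/splitPr: xq qE qe qv nuq => q1 q2.
  rewrite -{X}BX hwalk_cat /hedges /hverts !map_cat /=.
  rewrite cat_uniq => /and5P[_ _ _ Bx q2E] /and3P[_ _ q2e].
  rewrite mem_cat cat_uniq => /and4P[_ _ _ q2v].
  rewrite mem_cat negb_or => /andP[_ nuq].
  exists ((B, x) :: q2); split=> //; first by rewrite /= EB Bu Bx.
    by rewrite /= nuq.
  by rewrite /hend /hverts map_cat last_cat.
exists ((B, w) :: q); rewrite /= EB Bu Bw qE qe nBq; split=> //.
by move: qv; rewrite /= inE negb_or nuw nuq.
Qed.

Lemma hconnectedP E : hconnected E <-> span E = \top.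
Proof.
split=> [conn | sE u v _].
  apply/le_anti; rewrite lex1; apply/part_leP => u v _.
  have [-> | /conn[p /andP[pE _] <-]] := eqVneq u v; first exact: same_blockxx.
  exact: hwalk_span.
have /span_hwalk[p pE pv] : same_block (span E) u v.
  by rewrite sE -clumpT same_block_clump /clump_rel !inE orbT.
have [q [qE qe qv qp]] := hwalk_simple pE.
by exists q; rewrite ?qp // /hpath qE qe qv.
Qed.

(** Remove the last edge [B] of a cycle. The rest of the cycle connects two distinct vertices of
    [B], so [B] meets fewer than [#|B|] blocks spanned by the other edges and adds less than its
    weight to the rank. *)
Lemma tight_acyclic E v p : tight E -> ~~ hcycle E v p.
Proof.
move=> tE; apply/negP => /and3P[/and3P[pE pe puniq] /eqP vend p3].
have {puniq} : uniq (hverts p) by case/orP: puniq => [/andP[] | /andP[]].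
case/lastP: p => // q [B w] in pE pe vend p3 *; rewrite size_rcons in p3.
move: vend pE pe; rewrite -cats1 hwalk_cat hend_cat -[hend _ [:: _]]/w /= => {w}<-.
rewrite /hedges /hverts !map_cat !cats1 !rcons_uniq => /and5P[qE EB Bw Bv _].
case/andP=> nBq _ /andP[nvq _].
have q0 : (0 < size q)%N by lia.
have wq : hend v q \in hverts q.
  by case: q q0 {nBq nvq p3 qE Bw} => // s q _; rewrite /hend /= mem_last.
have nvw : hend v q != v by apply: contraNneq nvq => <-.
have /hwalk_span vw : hwalk (E :\ B) v q.
  apply: (hwalk_edges qE) => X qX; rewrite in_setD1 (hwalk_sub qE qX) andbT.
  by apply: contraNneq nBq => <-.
have B0 : B != set0 by apply/set0Pn; exists v.
have := part_rank_join_clump (span (E :\ B)) B0.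
rewrite -span1 -spanU setUC setD1K //.
have : (#|[set pblock (span (E :\ B)) x | x in B]| < #|B|)%N.
  rewrite ltn_neqAle leq_imset_card andbT; apply/imset_injP => inj.
  by case/eqP: nvw; apply: inj => //; apply/eqP; rewrite eq_pblockE same_block_sym.
have := part_rank_span_le (E :\ B); have := weightD1 EB; move: tE; rewrite /tight.
by lia.
Qed.

(** Remove an edge [B]; the rest is tight by induction. If two vertices of [B] shared a block of the
    remaining span, a simple path between them closed up by [B] would be a cycle. So [B] meets
    [#|B|] distinct blocks and adds its full weight to the rank. *)
Lemma acyclic_tight E :
    {in E, forall B, (1 < #|B|)%N} ->
    {in E &, forall B C, B != C -> (#|B :&: C| <= 1)%N} ->
    (forall v p, ~~ hcycle E v p) ->
  tight E.
Proof.
have [k] := ubnP #|E|; elim: k E => // k IH E; rewrite ltnS => ltk E1 Elin acyc.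
have [-> | [B EB]] := set_0Vmem E; first by rewrite /tight /weight big_set0.
have sE' : {subset E :\ B <= E} by apply/subsetP/subD1set.
have tE' : tight (E :\ B).
  apply: IH; first by rewrite (cardsD1 B) EB in ltk.
  - by move=> X /sE'/E1.
  - by move=> X Y /sE' EX /sE' EY; apply: Elin.
  move=> v p; apply: contraNN (acyc v p) => /and3P[/and3P[pE pe pv] vend p3].
  apply/and3P; split=> //; apply/and3P; split=> //.
  by apply: (hwalk_edges pE) => X /(hwalk_sub pE)/sE'.
have B0 : B != set0 by rewrite -card_gt0 ltnW ?E1.
have := part_rank_join_clump (span (E :\ B)) B0.
rewrite -span1 -spanU setUC setD1K //.
suff inj : {in B &, injective (pblock (span (E :\ B)))}.
  have -> : #|[set pblock (span (E :\ B)) x | x in B]| = #|B| by apply: card_in_imset.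
  move: tE' (weightD1 EB) (E1 B EB); rewrite /tight => tE' -> B1 rE.
  by move: #|B| (part_rank (span E)) (part_rank _) (weight _) rE tE' B1; lia.
move=> x y Bx By /eqP; rewrite eq_pblockE => xy; apply/eqP; apply: contraT => nxy.
have [p pE pxy] := span_hwalk xy; have [q [qE qe qv qend]] := hwalk_simple pE.
rewrite {}pxy in qend => {p pE}; case/negP: (acyc x (rcons q (B, x))).
have nBq : B \notin hedges q.
  by apply/negP => /(hwalk_sub qE); rewrite !inE eqxx.
apply/and3P; split; first (apply/and3P; split).
- rewrite -cats1 hwalk_cat qend /= EB By Bx !andbT.
  by apply: (hwalk_edges qE) => X /(hwalk_sub qE)/sE'.
- by rewrite /hedges map_rcons rcons_uniq nBq.
- rewrite -cats1 hend_cat eqxx /hverts cats1 map_rcons.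
  (* The vertices of the closed walk are a rotation of [x :: hverts q]. *)
  by rewrite -[uniq (rcons _ _)](rot_uniq (size (hverts q))) -cats1 rot_size_cat qv orbT.
- by rewrite -cats1 hend_cat.
(* Length at least three: an empty [q] would give [x = y], and a single edge would share both [x]
   and [y] with [B], against linearity. *)
rewrite size_rcons ltnS; case: q qE qend {qe qv} nBq => [|[X z] [|s q]] //.
  by move=> _ /eqP; rewrite (negbTE nxy).
rewrite /hend /= andbT => /and3P[/[!inE]/andP[nXB EX] Xx Xz] zy _; rewrite {}zy in Xz.
have := Elin _ _ EX EB nXB; rewrite leqNgt => /negP[].
by apply/card_gt1P; exists x, y; split; rewrite ?inE ?Xx ?Xz.
Qed.

Lemma hypertreeP E :
    {in E, forall B, (1 < #|B|)%N} ->
    {in E &, forall B C, B != C -> (#|B :&: C| <= 1)%N} ->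
  hypertree E <-> span E = \top /\ tight E.
Proof.
move=> E1 Elin; split=> [[/hconnectedP-> acyc] | [/hconnectedP conn tE]]; split=> //.
  by apply: acyclic_tight => // v p; apply/negP => cyc; apply: acyc; exists v, p.
by case=> v [p]; apply/negP/tight_acyclic.
Qed.

End Walks.

(** * Boolean sublattices of the partition lattice and their extensions *)

Section Extension.

Variable U : finType.
Implicit Types (P Q : Part U) (X : {set U}) (C D : {set Part U}).

Lemma hyperedges_gt1 D : {in hyperedges D, forall X, (1 < #|X|)%N}.
Proof. by move=> X; rewrite inE => /andP[]. Qed.

Lemma hyperedgesP D X :
  reflect ((1 < #|X|)%N /\ exists2 P, P \in D & X \in blocks P) (X \in hyperedges D).
Proof.
rewrite inE; apply: (iffP andP) => -[X1 H]; split=> //; first exact/exists_inP.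
exact/exists_inP.
Qed.

Lemma hyperedges_sub D D' : D \subset D' -> hyperedges D \subset hyperedges D'.
Proof.
move=> /subsetP sDD; apply/subsetP=> X /hyperedgesP[X1 [P /sDD DP PX]].
by apply/hyperedgesP; split=> //; exists P.
Qed.

Lemma span_hyperedges D : span (hyperedges D) = \join_(P in D) P.
Proof.
apply/le_anti/andP; split.
  apply/span_leP => X /hyperedgesP[_ [P DP PX]].
  apply: le_trans (joins_sup _ DP); apply/clump_leP => x y Xx.
  by rewrite (block_pblock PX Xx).
apply/joinsP => P DP; apply/part_leP => x y Pxy.
have [-> | nxy] := eqVneq x y; first exact: same_blockxx.
have EP : pblock P x \in hyperedges D.
  apply/hyperedgesP; split; last by exists P => //; apply: pblock_blocks.
  by apply/card_gt1P; exists x, y; split; rewrite //; apply: same_blockxx.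
by have /clump_leP := clump_le_span EP; apply=> //; apply: same_blockxx.
Qed.

Lemma weight_blocks P : weight (blocks P) = part_rank P.
Proof.
rewrite /part_rank -cardsT (card_partition (blocksP P)) -sum1_card -sumnB.
  by apply: eq_bigr => X _; rewrite subn1.
move=> X PX; rewrite card_gt0; case/and3P: (blocksP P) => _ _.
by apply: contraNneq => <-.
Qed.

Lemma weight_hyperedges_le D : (weight (hyperedges D) <= \sum_(P in D) part_rank P)%N.
Proof.
apply: (@leq_trans (weight (\bigcup_(P in D) blocks P))).
  rewrite (weight_setID (\bigcup_(P in D) _) (hyperedges D)) (setIidPr _) ?leq_addr //.
  by apply/subsetP=> X /hyperedgesP[_ [P DP PX]]; apply/bigcupP; exists P.
rewrite /weight; apply: (big_ind2 (fun (S : {set {set U}}) k => weight S <= k)%N).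
- by rewrite /weight big_set0.
- move=> S k T l hS hT; have := weightUI S T; lia.
- by move=> P _; rewrite weight_blocks.
Qed.

Lemma boolean_sublattice_bot C z o :
  \bot \in C -> {in C, forall P, z <= P <= o} -> z = \bot.
Proof. by move=> C0 /(_ _ C0)/andP[]; rewrite lex0 => /eqP. Qed.

Lemma boolean_sublattice_top C z o :
  \top \in C -> {in C, forall P, z <= P <= o} -> o = \top.
Proof. by move=> C1 /(_ _ C1)/andP[_]; rewrite le1x => /eqP. Qed.

Lemma part_rank_le_pred P : (0 < #|U|)%N -> (part_rank P <= #|U|.-1)%N.
Proof. by move/part_rank_top <-; rewrite part_rank_le ?lex1. Qed.

(** Joining all atoms successively to the least element raises the rank each time, and the rank
    never exceeds [#|U|.-1]. *)
Lemma card_atoms_le C : (0 < #|U|)%N -> boolean_sublattice C -> (#|atoms C| <= #|U|.-1)%N.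
Proof.
move=> U0 [[CI CU] Cd [z [o [Cz Co Czo Cc]]]].
apply: leq_trans (part_rank_le_pred o U0); apply: leq_trans (leq_addl (part_rank z) _) _.
apply: (atoms_above_leq CI CU Cd Cz Czo (@part_rank_lt U) Cz) => a aA; rewrite aA.
by have /(atomsP Cz Czo)[_ za _] := aA; rewrite lt_geF.
Qed.

Lemma card_boolean_sublattice_le C :
  (0 < #|U|)%N -> boolean_sublattice C -> (#|C| <= 2 ^ #|U|.-1)%N.
Proof.
move=> U0 bC; apply: leq_trans (leq_pexp2l _ (card_atoms_le U0 bC)) => //.
have [[CI CU] Cd [z [o [Cz Co Czo Cc]]]] := bC.
exact: card_boolean_sublattice CI Cd Cz Czo Cc.
Qed.

Section BoundedBoolean.

Variable B : {set Part U}.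
Hypotheses (U_gt0 : (0 < #|U|)%N) (boolB : boolean_sublattice B).
Hypotheses (botB : \bot \in B) (topB : \top \in B).

Lemma boolean_bounded :
  [/\ {in B &, forall x y, x `&` y \in B}, {in B &, forall x y, x `|` y \in B},
      {in B & &, forall x y w, x `&` (y `|` w) = (x `&` y) `|` (x `&` w)},
      {in B, forall x, \bot <= x <= \top}
    & {in B, forall x, exists2 y, y \in B & x `&` y = \bot /\ x `|` y = \top}].
Proof.
have [[BI BU] Bd [z [o [Bz Bo Bzo Bc]]]] := boolB.
have z0 := boolean_sublattice_bot botB Bzo; have o1 := boolean_sublattice_top topB Bzo.
by rewrite z0 o1 in Bzo Bc *; split.
Qed.

Lemma atoms_meet : {in atoms B &, forall P Q, P != Q -> P `&` Q = \bot}.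
Proof.
have [BI BU Bd B01 Bc] := boolean_bounded.
move=> P Q PA QA nPQ; have /(atomsP botB B01)[BP P0 Pmin] := PA.
have /(atomsP botB B01)[BQ Q0 Qmin] := QA.
apply: (meet_atom BI botB B01 BQ PA); apply: contraNN nPQ => PQ.
by rewrite (Qmin _ BP P0 PQ).
Qed.

(** Two common points of blocks of different atoms would be related in the meet of these atoms,
    which is the bottom; different blocks of one atom are disjoint. *)
Lemma hyperedges_atoms_linear :
  {in hyperedges (atoms B) &, forall X Y, X != Y -> (#|X :&: Y| <= 1)%N}.
Proof.
move=> X Y /hyperedgesP[_ [P PA PX]] /hyperedgesP[_ [Q QA QY]] nXY.
rewrite leqNgt; apply/negP => /card_gt1P[x [y [/setIP[Xx Yx] /setIP[Xy Yy] nxy]]].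
move: nXY Xy Yy; rewrite (block_pblock PX Xx) (block_pblock QY Yx) => nXY Pxy Qxy.
have [ePQ | nPQ] := eqVneq P Q; first by rewrite ePQ eqxx in nXY.
case/negP: nxy; rewrite -same_block_bot -(atoms_meet PA QA nPQ).
by rewrite same_block_of_rel /same_block Pxy.
Qed.

Lemma join_atoms P : P \in B -> P = \join_(a in [set a in atoms B | a <= P]) a.
Proof.
have [BI BU Bd B01 Bc] := boolean_bounded => BP.
apply/le_anti/andP; split; last by apply/joinsP => a; rewrite inE => /andP[].
apply: (le_from_atoms BI Bd botB B01 Bc BP) => [|a aA aP].
  apply: (big_ind (fun Q => Q \in B)) => // a.
  by rewrite inE => /andP[/(atomsP botB B01)[]].
by apply: joins_sup; rewrite inE aA.
Qed.

Lemma mem_span_atoms P : P \in B ->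
  exists2 S : {set {set U}}, S \subset hyperedges (atoms B) & P = span S.
Proof.
move=> BP; exists (hyperedges [set a in atoms B | a <= P]).
  by apply: hyperedges_sub; apply/subsetP=> a; rewrite inE => /andP[].
by rewrite span_hyperedges -join_atoms.
Qed.

Lemma span_atoms : span (hyperedges (atoms B)) = \top.
Proof.
have [S sS eS] := mem_span_atoms topB.
by apply/le_anti; rewrite lex1 /= eS span_sub.
Qed.

(** Connectedness is automatic because the atoms of [B] join to the top; only acyclicity remains. *)
Lemma hypertree_atomsP :
  hypertree (hyperedges (atoms B)) <-> tight (hyperedges (atoms B)).
Proof.
have H := hypertreeP (@hyperedges_gt1 (atoms B)) hyperedges_atoms_linear.
by split=> [/H[] // | tA]; apply/H; rewrite span_atoms.
Qed.

Lemma large_extension_tight C : boolean_sublattice C -> B \subset C ->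
  (2 ^ #|U|.-1 <= #|C|)%N -> tight (hyperedges (atoms B)).
Proof.
move=> bC /subsetP sBC cC; have atC := card_atoms_le U_gt0 bC.
have [[CI CU] Cd [z [o [Cz Co Czo Cc]]]] := bC.
have [BI BU Bd B01 Bc] := boolean_bounded.
have z0 := boolean_sublattice_bot (sBC _ botB) Czo.
have {cC} atC' : (#|U|.-1 <= #|atoms C|)%N.
  rewrite -(leq_exp2l (m := 2)) //; apply: leq_trans cC _.
  exact: card_boolean_sublattice CI Cd Cz Czo Cc.
(* Each atom of [C] not below [P] accounts for one unit of rank above [P], and the total rank
   available is at most the number of atoms of [C]. *)
have rC P : P \in C -> (part_rank P <= #|[set a in atoms C | (a <= P)%O]|)%N.
  move=> CP; pose S := [set a in atoms C | ~~ (a <= P)].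
  have : (part_rank P + #|S| <= part_rank o)%N.
    apply: (atoms_above_leq CI CU Cd Cz Czo (@part_rank_lt U) CP) => a.
    by rewrite inE.
  have := part_rank_le_pred o U_gt0.
  have : (#|[set a in atoms C | (a <= P)%O]| + #|S| = #|atoms C|)%N.
    rewrite -(cardsID [set a | a <= P] (atoms C)); congr (_ + _)%N.
      by apply: eq_card => a; rewrite !inE.
    by apply: eq_card => a; rewrite !inE andbC.
  move: atC'; move: #|S| #|_| #|atoms C| (part_rank P) (part_rank o) => s t c p r.
  by lia.
rewrite /tight span_atoms part_rank_top //.
apply: leq_trans (weight_hyperedges_le _) (leq_trans _ atC).
(* Double counting of the pairs [a <= P]: an atom [a] of [C] lies below at most one atom [P] of [B],
   since distinct atoms of [B] meet in the bottom. *)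
apply: (@leq_trans (\sum_(P in atoms B) \sum_(a in atoms C | (a <= P)%O) 1)%N).
  apply: leq_sum => P /(atomsP botB B01)[/sBC/rC le _ _]; apply: leq_trans le _.
  by rewrite -sum1_card; apply: eq_leq; apply: eq_bigl => a; rewrite inE.
rewrite (exchange_big_dep [in atoms C]) /=; last by move=> P a _ /andP[].
rewrite -[leqRHS]sum1_card; apply: leq_sum => a aC.
rewrite sum1dep_card; apply/card_le1_eqP => P Q; rewrite [P \in _]inE [Q \in _]inE.
case/and3P=> PA _ aP /and3P[QA _ aQ]; apply/eqP; apply: contraT; rewrite eq_sym => nPQ.
have /(atomsP Cz Czo)[_ za _] := aC.
suff: a <= z by rewrite lt_geF.
by rewrite z0 -(atoms_meet PA QA nPQ) lexI aP aQ.
Qed.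

End BoundedBoolean.

End Extension.

Theorem theorem4p4 (U : finType) (B : {set Part U}) :
  (0 < #|U|)%N ->
  boolean_sublattice B ->
  \bot \in B ->
  \top \in B ->
  (exists C : {set Part U},
     [/\ boolean_sublattice C,
         B \subset C
       & forall C' : {set Part U}, boolean_sublattice C' -> (#|C'| <= #|C|)%N])
  <-> hypertree (hyperedges (atoms B)).
Proof.
move=> U0 bB B0 B1; split=> [[C [bC sBC maxC]] | /(hypertree_atomsP bB B0 B1) tA].
  apply/(hypertree_atomsP bB B0 B1)/(large_extension_tight U0 bB B0 B1 bC sBC).
  (* Maximality of [C] is used only against one sublattice of size [2 ^ #|U|.-1], which need not
     contain [B]. *)
  by have [D bD <-] := exists_large_boolean_sublattice U0; apply: maxC.
have [bC cC] := star_sublattice U0 tA (span_atoms bB B0 B1).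
exists (span_sublattice (stars (hyperedges (atoms B)))); split=> //.
  by apply/subsetP=> P /(mem_span_atoms bB B0 B1)[S sS ->]; apply: span_in_star_sublattice.
by move=> C' bC'; rewrite cC card_boolean_sublattice_le.
Qed.
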